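(* Let $G$ be a connected graph on $n$ vertices. Then $G\in\mathcal{G}$ if and only if $\operatorname{th}_+(G)=n-1$.
   Context: All graphs are finite, simple and undirected. $\alpha(G)$ is the independence number of $G$ (the largest size of an independent set). The family $\mathcal{G}$ consists of all graphs $G$ such that $\alpha(G)=2$ and $G$ has no induced subgraph isomorphic to $C_5$, the house, or the double diamond. Here $C_5$ is the $5$-cycle; the house is the $5$-cycle with exactly one chord added; the double diamond is the graph on six vertices $a_1,a_2,a_3,b_1,b_2,b_3$ with exactly the nine edges $a_1a_2,\ a_2a_3,\ b_1b_2,\ b_2b_3,\ a_1b_1,\ a_2b_2,\ a_3b_3,\ a_1b_2,\ a_2b_3$. Positive semidefinite (PSD) color change rule: each vertex of $G$ is blue or white; let $B$ be the current set of blue vertices and let $W_1,\dots,W_k$ be the vertex sets of the connected components of $G-B$. A white vertex $w\in W_i$ is colored blue (is forced by the blue vertex $v$) when $w$ is the only white neighbor of $v$ in the induced subgraph $G[W_i\cup B]$. Starting with exactly the vertices of $S\subseteq V(G)$ blue, at each time step all possible forces are performed simultaneously. $S$ is a PSD zero forcing set if eventually all vertices become blue; in that case $\operatorname{pt}_+(G;S)$ is the number of time steps needed to color all vertices blue (so it is $0$ if $S=V(G)$), and otherwise $\operatorname{pt}_+(G;S)=\infty$. Define $\operatorname{th}_+(G;S)=|S|+\operatorname{pt}_+(G;S)$, and the PSD throttling number $\operatorname{th}_+(G)=\min\{\operatorname{th}_+(G;S): S \text{ is a PSD zero forcing set of } G\}$. *)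

(* Defs.v *)
From mathcomp Require Import all_boot.

Set Implicit Arguments.
Unset Strict Implicit.
Unset Printing Implicit Defensive.

(* Throughout, a finite simple graph is a symmetric irreflexive relation
   [e : rel T] on a finite type [T] of vertices. *)

Definition connected_graph (T : finType) (e : rel T) : Prop :=
  0 < #|T| /\ forall x y : T, connect e x y.

Section Independence.
Variables (T : finType) (e : rel T).

Definition independent (A : {set T}) : bool :=
  [forall x in A, forall y in A, ~~ e x y].

Definition independence_number : nat :=
  \max_(A : {set T} | independent A) #|A|.

End Independence.

Definition has_induced (U : finType) (h : rel U) (T : finType) (e : rel T) :
    Prop :=
  exists f : U -> T, injective f /\ forall i j : U, e (f i) (f j) = h i j.

Definition graph_of_edges (m : nat) (E : seq (nat * nat)) : rel 'I_m :=
  fun i j => ((val i, val j) \in E) || ((val j, val i) \in E).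

Definition C5_edges : seq (nat * nat) :=
  [:: (0, 1); (1, 2); (2, 3); (3, 4); (4, 0)].

Definition C5_graph : rel 'I_5 := graph_of_edges C5_edges.

Definition house_graph : rel 'I_5 := graph_of_edges ((0, 2) :: C5_edges).

(* The vertices a1, a2, a3, b1, b2, b3 are 0, 1, 2, 3, 4, 5. *)
Definition double_diamond_graph : rel 'I_6 :=
  graph_of_edges
    [:: (0, 1); (1, 2); (3, 4); (4, 5);
        (0, 3); (1, 4); (2, 5); (0, 4); (1, 5)].

Definition in_family_G (T : finType) (e : rel T) : Prop :=
  [/\ independence_number e = 2,
      ~ has_induced C5_graph e,
      ~ has_induced house_graph e &
      ~ has_induced double_diamond_graph e].

Section PSDThrottling.
Variables (T : finType) (e : rel T).
Implicit Types (B S : {set T}) (v w : T).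

(* For [w \notin B], the vertex set of the component of G - B containing w. *)
Definition white_component B w : {set T} :=
  [set x | connect [rel y z | [&& y \notin B, z \notin B & e y z]] w x].

(* With B the set of blue vertices, the blue vertex v forces w. *)
Definition psd_forces B v w : bool :=
  [&& v \in B, w \notin B &
      [set x in white_component B w :|: B | (x \notin B) && e v x] == [set w]].

Definition psd_step B : {set T} :=
  B :|: [set w | [exists v, psd_forces B v w]].

(* Some iterate of [psd_step] maps S to the set of all vertices. *)
Definition psd_zero_forcing S : bool := fconnect psd_step S [set: T].

(* [None] stands for infinity. When y is reachable from x by iterating f,
   [findex f x y] is the least i such that [iter i f x = y]. *)
Definition psd_pt S : option nat :=
  if psd_zero_forcing S then Some (findex psd_step S [set: T]) else None.

Definition psd_th_set S : option nat := omap (addn #|S|) (psd_pt S).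

Definition psd_th_value (k : nat) : bool :=
  [exists (S | psd_zero_forcing S), psd_th_set S == Some k].

Lemma psd_th_value_exists : exists k, psd_th_value k.
Proof.
exists (#|[set: T]| + findex psd_step [set: T] [set: T]).
apply/existsP; exists [set: T].
by rewrite /psd_th_set /psd_pt /psd_zero_forcing connect0 /=.
Qed.

Definition psd_throttling_number : nat := ex_minn psd_th_value_exists.

End PSDThrottling.

(* Main.v *)
Require Import Defs.
From mathcomp Require Import all_boot.

Set Implicit Arguments.
Unset Strict Implicit.
Unset Printing Implicit Defensive.

(** For a connected graph with independence number [alpha >= 2], leaving a
    maximum independent set white and waiting one step gives
    [th+ <= n - alpha + 1], while a complete graph has [th+ >= n]. So
    [th+ = n - 1] forces [alpha = 2]. Call [w - t] the gain of a starting set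
    that leaves [w] vertices white and turns everything blue in [t] steps: the
    number of forced vertices in excess of one per step. When [alpha = 2],
    [th+ = n - 1] means that no starting set has gain 2 or more.

    C5, the house and the double diamond are exactly the local obstructions.
    If one of them is induced, making blue two well-chosen vertices of it and
    every vertex outside it yields gain 2 ([pentagon_throttling],
    [double_diamond_throttling]).

    Conversely, with [alpha = 2] there are at most two white components, and
    when there are two they are cliques. If two vertices of one component are
    forced at once while a third white vertex exists, C5 or a house appears
    ([forced_same_component_absurd]). So a step gains at most 1, and it gains
    either by forcing the last two white vertices or by one force in each of
    two components. In the latter case, if both components survive the step,
    one finds a double diamond or a house ([forced_two_components_absurd]).
    Hence one of the components was a single vertex [z], which sees none of the
    vertices that remain white; such a witness excludes any further gain
    ([far_vertex_white_le_time]). The total gain is at most 1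
    ([white_le_time]). *)

(** * Independence number and induced subgraphs *)

Definition adjacency_rows m (E : seq (nat * nat)) : seq (seq bool) :=
  [seq [seq ((i, j) \in E) || ((j, i) \in E) | j <- iota 0 m] | i <- iota 0 m].

Section Graph.
Variables (T : finType) (e : rel T).
Hypotheses (e_sym : symmetric e) (e_irr : irreflexive e).

Lemma independence_number_geP k :
  reflect (exists2 A : {set T}, independent e A & k <= #|A|)
          (k <= independence_number e).
Proof.
have ind0 : independent e set0 by apply/forall_inP => x; rewrite inE.
apply: (iffP idP) => [|[A indA]]; last first.
  by move/leq_trans; apply; exact: leq_bigmax_cond.
have [|A indA maxA] := @eq_bigmax_cond _ (independent e) (fun A => #|A|).
  by apply/card_gt0P; exists set0.
by exists A => //; rewrite -maxA.
Qed.

Lemma independence_number_gt1P :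
  reflect (exists x y, x != y /\ ~~ e x y) (1 < independence_number e).
Proof.
apply: (iffP (independence_number_geP _)) => [[A indA]|[x [y [xy nxy]]]].
  case/card_gt1P=> x [y [Ax Ay xy]]; exists x, y; split=> //.
  exact: (forall_inP (forall_inP indA x Ax)).
exists [set x; y]; last by rewrite cards2 xy.
apply/forall_inP => a /set2P Aa; apply/forall_inP => b /set2P Ab.
by case: Aa => ->; case: Ab => ->; rewrite ?e_irr // e_sym.
Qed.

Lemma independence_number_gt2P :
  reflect (exists x y z, [/\ x != y, x != z & y != z] /\
                         [/\ ~~ e x y, ~~ e x z & ~~ e y z])
          (2 < independence_number e).
Proof.
apply: (iffP (independence_number_geP _)) => [[A indA]|].
  case/card_gt2P=> x [y [z [[Ax Ay Az] [xy yz zx]]]]; exists x, y, z.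
  have ind a b : a \in A -> b \in A -> ~~ e a b.
    by move=> Aa; apply: (forall_inP (forall_inP indA a Aa)).
  by rewrite (eq_sym x z) !ind //.
move=> [x [y [z [[xy xz yz] [nxy nxz nyz]]]]].
exists [set x; y; z]; last first.
  by apply/card_gt2P; exists x, y, z; rewrite !inE !eqxx !orbT (eq_sym z).
apply/forall_inP => a; rewrite !inE -orbA => Aa.
apply/forall_inP => b; rewrite !inE -orbA => Ab.
by case/or3P: Aa => /eqP ->; case/or3P: Ab => /eqP ->;
   rewrite ?e_irr // e_sym.
Qed.

(** In a graph whose vertices have pairwise distinct neighbourhoods, a map that
    preserves and reflects adjacency is automatically injective, so injectivity
    of the copy reduces to a computation on the small graph alone. *)
Lemma has_induced_nth m (E : seq (nat * nat)) x0 (s : seq T) :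
  let h := @graph_of_edges m E in
  uniq (adjacency_rows m E) -> all (fun i => (i, i) \notin E) (iota 0 m) ->
  (forall i j : 'I_m, i < j -> e (nth x0 s i) (nth x0 s j) = h i j) ->
  has_induced h e.
Proof.
move=> h uniq_rows loopless Eh_lt; pose f (i : 'I_m) := nth x0 s i.
have h_irr i : h i i = false.
  have := allP loopless i; rewrite mem_iota ltn_ord => /(_ isT)/negPf.
  by rewrite /h /graph_of_edges orbb.
have Eh i j : e (f i) (f j) = h i j.
  case: (ltngtP i j) => [||/val_inj->]; [exact: Eh_lt| |by rewrite e_irr h_irr].
  by rewrite e_sym /h /graph_of_edges orbC; apply: Eh_lt.
exists f; split=> // i j fij; apply/val_inj/eqP.
have sz_rows: size (adjacency_rows m E) = m by rewrite size_map size_iota.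
rewrite /= -(nth_uniq [::] _ _ uniq_rows) ?sz_rows //.
rewrite !(nth_map 0) ?size_iota // !nth_iota //.
apply/eqP/eq_in_map => k; rewrite mem_iota => /andP[_ lt_k].
by have := Eh i (Ordinal lt_k); rewrite fij Eh.
Qed.

(** The pair [v0 v2] is left free: a pentagon is an induced C5 when it is a
    non-edge and an induced house when it is an edge. Both arguments of the
    proof, extracting a forbidden graph and exploiting one, are insensitive to
    that pair, so the two graphs are handled as one. *)
Definition pentagon v0 v1 v2 v3 v4 :=
  [/\ e v0 v1, e v1 v2, e v2 v3, e v3 v4 & e v4 v0] /\
  [/\ ~~ e v0 v3, ~~ e v1 v3, ~~ e v1 v4 & ~~ e v2 v4].

Lemma pentagon_induced v0 v1 v2 v3 v4 :
  pentagon v0 v1 v2 v3 v4 ->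
  has_induced C5_graph e \/ has_induced house_graph e.
Proof.
move=> [[e01 e12 e23 e34 e40]].
move=> [/negPf n03 /negPf n13 /negPf n14 /negPf n24].
have e04 : e v0 v4 by rewrite e_sym.
case e02 : (e v0 v2); [right | left];
  apply: (has_induced_nth (x0 := v0) (s := [:: v0; v1; v2; v3; v4]));
  by [|case=> [[|[|[|[|[|[|?]]]]]] // ?] [[|[|[|[|[|[|?]]]]]] // ?]].
Qed.

Lemma induced_pentagon :
  has_induced C5_graph e \/ has_induced house_graph e ->
  exists v0 v1 v2 v3 v4, pentagon v0 v1 v2 v3 v4.
Proof.
case=> -[f [_ Ef]];
  exists (f (@Ordinal 5 0 isT)), (f (@Ordinal 5 1 isT)), (f (@Ordinal 5 2 isT)),
    (f (@Ordinal 5 3 isT)), (f (@Ordinal 5 4 isT));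
  by rewrite /pentagon !Ef.
Qed.

Lemma double_diamond_induced a1 a2 a3 b1 b2 b3 :
  [/\ e a1 a2, e a2 a3, e b1 b2 & e b2 b3] ->
  [/\ e a1 b1, e a2 b2, e a3 b3, e a1 b2 & e a2 b3] ->
  [/\ ~~ e a1 a3, ~~ e b1 b3 & ~~ e a1 b3] ->
  [/\ ~~ e a2 b1, ~~ e a3 b1 & ~~ e a3 b2] ->
  has_induced double_diamond_graph e.
Proof.
move=> [a12 a23 b12 b23] [ab11 ab22 ab33 ab12 ab23].
move=> [/negPf a13 /negPf b13 /negPf ab13] [/negPf ab21 /negPf ab31 /negPf ab32].
apply: (has_induced_nth (x0 := a1) (s := [:: a1; a2; a3; b1; b2; b3]));
  by [|case=> [[|[|[|[|[|[|?]]]]]] // ?] [[|[|[|[|[|[|?]]]]]] // ?]].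
Qed.

End Graph.

(** * White components and forces *)

Section Forcing.
Variables (T : finType) (e : rel T).
Hypotheses (e_sym : symmetric e) (e_irr : irreflexive e).
Implicit Types (B S C : {set T}) (v w x y z : T).

Lemma white_component_refl B w : w \in white_component e B w.
Proof. by rewrite inE. Qed.

Lemma white_component_edge B w x y :
  x \in white_component e B w -> x \notin B -> y \notin B -> e x y ->
  y \in white_component e B w.
Proof.
rewrite !inE => wx xB yB xy; apply: connect_trans wx (connect1 _).
by rewrite /= xB yB.
Qed.

Lemma white_component_trans B w x y :
  x \in white_component e B w -> y \in white_component e B x ->
  y \in white_component e B w.
Proof. by rewrite !inE; apply: connect_trans. Qed.

Lemma white_component_sym B w x :
  (x \in white_component e B w) = (w \in white_component e B x).
Proof.
by rewrite !inE; apply: sym_connect_sym => y z /=; rewrite andbCA e_sym.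
Qed.

Lemma white_component_sub B w C :
  w \in C ->
  (forall x y, x \in C -> x \notin B -> y \notin B -> e x y -> y \in C) ->
  white_component e B w \subset C.
Proof.
move=> Cw closedC; apply/subsetP => x; rewrite inE => /connectP[p].
elim: p w Cw => [|y p IHp] w Cw /=; first by move=> _ ->.
by move=> /andP[/and3P[wB yB wy]]; apply: IHp; apply: closedC wy.
Qed.

Lemma psd_forces_edge B v w :
  psd_forces e B v w -> [/\ v \in B, w \notin B & e v w].
Proof.
case/and3P=> vB wB /eqP/setP/(_ w); rewrite [in RHS]inE eqxx inE.
by case/andP=> _ /andP[].
Qed.

Lemma psd_forces_only B v w x :
  psd_forces e B v w -> x \in white_component e B w -> x \notin B -> x != w ->
  ~~ e v x.
Proof.
case/and3P=> _ _ /eqP/setP/(_ x); rewrite !in_set => Ex wx xB nxw.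
by move: Ex; rewrite in_set1 (negPf nxw) wx xB /= => ->.
Qed.

(** The list [w :: C] is meant to hold the white component of [w] and [R] the
    other white vertices; only the absence of edges between them matters, so
    the component never has to be computed exactly. *)
Lemma psd_forcesI B v w (C R : seq T) :
  v \in B -> w \notin B -> e v w -> (forall x, x \notin B -> x \in (w :: C) ++ R) ->
  allrel (fun x y => ~~ e x y) (w :: C) R -> all (fun x => ~~ e v x) C ->
  psd_forces e B v w.
Proof.
move=> vB wB vw whiteB /allrelP sepR /allP only_w; apply/and3P; split=> //.
have sub : white_component e B w \subset [set x in w :: C].
  apply: white_component_sub => [|x y]; first by rewrite inE mem_head.
  rewrite !in_set => Cx _ /whiteB; rewrite mem_cat => /orP[//|Ry].
  by rewrite (negPf (sepR _ _ Cx Ry)).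
apply/eqP/setP => x; rewrite inE in_setU in_set1.
apply/idP/eqP => [/and3P[/orP[/(subsetP sub)|->//] + xB vx]|->]; last first.
  by rewrite white_component_refl wB.
rewrite !inE => /orP[/eqP//|/only_w]; by rewrite vx.
Qed.

Definition forced B : {set T} := [set w | [exists v, psd_forces e B v w]].

Lemma forcedP B w : reflect (exists v, psd_forces e B v w) (w \in forced B).
Proof. by rewrite inE; apply: existsP. Qed.

Lemma card_white_step B : #|~: B| <= #|~: psd_step e B| + #|forced B|.
Proof.
apply: leq_trans (leq_card_setU _ _); apply: subset_leq_card.
by apply/subsetP => x; rewrite /psd_step !in_set => /negPf->; case: [exists _, _].
Qed.

Lemma sub_psd_step B : B \subset psd_step e B.
Proof. exact: subsetUl. Qed.

(** One force per step is the pace of a process that gains nothing: every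
    white vertex costs a time step. *)
Lemma slow_forcing S t :
  (forall B, S \subset B -> #|forced B| <= 1) ->
  iter t (psd_step e) S = setT -> #|~: S| <= t.
Proof.
elim: t S => [|t IHt] S slowS; first by move=> /= ->; rewrite setCT cards0.
rewrite iterSr => /IHt slow_step.
apply: leq_trans (card_white_step S) _; rewrite -addn1.
apply: leq_add (slowS _ (subxx S)); apply: slow_step => B subB.
by apply/slowS/(subset_trans (sub_psd_step S)).
Qed.

(** * The throttling number as a minimum over iterates *)

(** An iterate equal to [setT] bounds the throttling number even if it is not
    the first one, so no propagation time has to be computed exactly. *)
Lemma throttling_le S t :
  iter t (psd_step e) S = setT -> psd_throttling_number e <= #|S| + t.
Proof.
move=> St; rewrite /psd_throttling_number; case: ex_minnP => m _ min_m.
have Sforce : psd_zero_forcing e S by rewrite /psd_zero_forcing -St fconnect_iter.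
have le_t : findex (psd_step e) S setT <= t.
  have [lt_t|] := ltnP t (order (psd_step e) S).
    by rewrite -St findex_iter.
  by apply: leq_trans; apply/ltnW/findex_max.
apply: leq_trans (min_m _ _) (leq_add (leqnn _) le_t).
by apply/existsP; exists S; rewrite /psd_th_set /psd_pt Sforce /=.
Qed.

Lemma throttling_ge k :
  (forall S t, iter t (psd_step e) S = setT -> k <= #|S| + t) ->
  k <= psd_throttling_number e.
Proof.
move=> bound; rewrite /psd_throttling_number; case: ex_minnP => m + _.
case/existsP=> S /andP[Sforce]; rewrite /psd_th_set /psd_pt Sforce /=.
by case/eqP=> <-; apply/bound/iter_findex.
Qed.

(** Starting from all vertices but [C] saves [#|C|] vertices for [t] steps, so
    a gain of two puts the throttling number below [#|T| - 1]. *)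
Lemma throttling_lt C t :
  iter t (psd_step e) (~: C) = setT -> t.+1 < #|C| ->
  psd_throttling_number e < #|T| - 1.
Proof.
move=> /throttling_le th_le lt_t; apply: leq_ltn_trans th_le _.
by rewrite ltn_subRL addnCA add1n -(cardsC C) [#|C| + _]addnC ltn_add2l.
Qed.

(** * Fast starting sets *)

Lemma independent_one_step C :
  independent e C -> (forall w, exists v, e v w) -> psd_step e (~: C) = setT.
Proof.
move=> indC no_isolated; apply/setP => w; rewrite in_setT in_setU in_setC.
case: (boolP (w \in C)) => //= Cw; apply/forcedP.
have indC' x y : x \in C -> y \in C -> ~~ e x y.
  by move=> Cx; apply: (forall_inP (forall_inP indC x Cx)).
have [v vw] := no_isolated w; exists v.
apply: (@psd_forcesI _ _ _ [::] (enum C)); rewrite ?inE ?Cw //.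
- by apply: contraL vw => Cv; apply: indC'.
- by move=> x; rewrite !inE negbK mem_enum => ->; rewrite orbT.
- by rewrite allrel1l; apply/allP => x; rewrite mem_enum; apply: indC'.
Qed.

Lemma connected_no_isolated :
  connected_graph e -> 1 < #|T| -> forall w, exists v, e v w.
Proof.
move=> [_ conn] /card_gt1P[x [y [_ _ xy]]] w.
have [z wz] : exists z, w != z.
  by case: (eqVneq w x) => [->|wx]; [exists y | exists x].
have /connectP[[|v p] /=] := conn w z; first by move=> _ zw; rewrite zw eqxx in wz.
by case/andP=> wv _ _; exists v; rewrite e_sym.
Qed.

(** Leave [v1], [v3], [v4] white. As [v1] sees neither [v3] nor [v4], vertex
    [v0] may force both [v1] and [v4] while [v2] forces [v3]: three vertices
    in one step. *)
Lemma pentagon_throttling v0 v1 v2 v3 v4 :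
  pentagon e v0 v1 v2 v3 v4 -> psd_throttling_number e < #|T| - 1.
Proof.
move=> [[e01 e12 e23 e34 e40] [n03 n13 n14 n24]].
have [] : uniq [:: v0; v1; v2; v3; v4] /\ [/\ ~~ e v3 v1, ~~ e v4 v1 & ~~ e v4 v2].
  rewrite ![e v3 _]e_sym ![e v4 _]e_sym; split=> //.
  (* No two of the five vertices are adjacent to the same ones. *)
  move: (e_irr v0) (e_irr v1) (e_irr v2) (e_irr v3) (e_irr v4).
  move: (e_sym v0 v1) (e_sym v0 v4) (e_sym v1 v2) (e_sym v2 v3) (e_sym v3 v4).
  move: n03 n13 n14 n24 => /negPf n03 /negPf n13 /negPf n14 /negPf n24 *.
  by rewrite /= !inE !negb_or -!andbA; do !(apply/andP; split); apply/eqP => //;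
    congruence.
rewrite /= !inE !negb_or => /and5P[/and4P[d01 d02 d03 d04] /and3P[d12 d13 d14]].
move=> /andP[d23 d24] d34 _ [n31 n41 n42].
pose W := [set v1; v3; v4].
have whiteW x : x \notin ~: W -> [\/ x = v1, x = v3 | x = v4].
  by rewrite !inE negbK -orbA => /or3P[]/eqP->; constructor.
apply: (@throttling_lt W 1); last first.
  by rewrite /W -setUA cardsU1 cards2 !inE negb_or d13 d14 d34.
apply/setP => w; rewrite in_setT /= in_setU.
have [//|/whiteW Ww] := boolP (w \in ~: W); apply/forcedP.
have e20 : e v2 v1 by rewrite e_sym.
have e04 : e v0 v4 by rewrite e_sym.
case: Ww => ->; [exists v0 | exists v2 | exists v0].
- apply: (@psd_forcesI (~: W) _ _ [::] [:: v3; v4]);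
    rewrite /allrel /= ?inE ?negbK ?negb_or ?eqxx ?d01 ?d03 ?d04 ?orbT ?n13 ?n14 //.
  by move=> x /whiteW[]->; rewrite !inE eqxx ?orbT.
- apply: (@psd_forcesI (~: W) _ _ [:: v4] [:: v1]);
    rewrite /allrel /= ?inE ?negbK ?negb_or ?eqxx
      ?(eq_sym v2 v1) ?d12 ?d23 ?d24 ?orbT ?n31 ?n41 ?n24 //.
  by move=> x /whiteW[]->; rewrite !inE eqxx ?orbT.
- apply: (@psd_forcesI (~: W) _ _ [:: v3] [:: v1]);
    rewrite /allrel /= ?inE ?negbK ?negb_or ?eqxx
      ?d01 ?d03 ?d04 ?orbT ?n31 ?n41 ?n03 //.
  by move=> x /whiteW[]->; rewrite !inE eqxx ?orbT.
Qed.

(** Leave [a1], [b1], [a3], [b3] white. The edges [a1 b1] and [a3 b3] have no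
    edge between them; [a2] and [b2] force [a1] and [b3] in the first step, then
    [b2] and [a2] force [b1] and [a3] in the second. *)
Lemma double_diamond_throttling :
  has_induced double_diamond_graph e -> psd_throttling_number e < #|T| - 1.
Proof.
move=> [f [f_inj Ef]].
pose a1 := f (@Ordinal 6 0 isT); pose a2 := f (@Ordinal 6 1 isT).
pose a3 := f (@Ordinal 6 2 isT); pose b1 := f (@Ordinal 6 3 isT).
pose b2 := f (@Ordinal 6 4 isT); pose b3 := f (@Ordinal 6 5 isT).
have [e_a2a1 e_a2a3 e_b2b1 e_b2b3] : [/\ e a2 a1, e a2 a3, e b2 b1 & e b2 b3].
  by rewrite !Ef.
have [n_a2b1 n_b2a3] : ~~ e a2 b1 /\ ~~ e b2 a3 by rewrite !Ef.
have [n_a1a3 n_a1b3 n_b1a3 n_b1b3] :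
    [/\ ~~ e a1 a3, ~~ e a1 b3, ~~ e b1 a3 & ~~ e b1 b3] by rewrite !Ef.
have [n_a3a1 n_b3a1 n_a3b1 n_b3b1] :
    [/\ ~~ e a3 a1, ~~ e b3 a1, ~~ e a3 b1 & ~~ e b3 b1] by rewrite !Ef.
pose W := [set a1; b1; a3; b3].
have whiteW x : x \notin ~: W -> [\/ x = a1, x = b1, x = a3 | x = b3].
  by rewrite !inE negbK -!orbA => /or4P[]/eqP->; constructor.
have blue_a2 : a2 \in ~: W by rewrite !inE /a1 /a2 /a3 /b1 /b3 !(inj_eq f_inj).
have blue_b2 : b2 \in ~: W by rewrite !inE /a1 /a3 /b1 /b2 /b3 !(inj_eq f_inj).
apply: (@throttling_lt W 2); last first.
  by rewrite /W -!setUA cardsU1 cardsU1 cards2 !inE /a1 /a3 /b1 /b3 !(inj_eq f_inj).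
have step_a1 : a1 \in psd_step e (~: W).
  rewrite in_setU; apply/orP; right; apply/forcedP; exists a2.
  apply: (@psd_forcesI (~: W) _ _ [:: b1] [:: a3; b3]);
    rewrite ?blue_a2 /allrel /= ?inE ?negbK ?eqxx ?orbT
      ?n_a2b1 ?n_a1a3 ?n_a1b3 ?n_b1a3 ?n_b1b3 //.
  by move=> x /whiteW[]->; rewrite !inE eqxx ?orbT.
have step_b3 : b3 \in psd_step e (~: W).
  rewrite in_setU; apply/orP; right; apply/forcedP; exists b2.
  apply: (@psd_forcesI (~: W) _ _ [:: a3] [:: a1; b1]);
    rewrite ?blue_b2 /allrel /= ?inE ?negbK ?eqxx ?orbT
      ?n_b2a3 ?n_a3a1 ?n_b3a1 ?n_a3b1 ?n_b3b1 //.
  by move=> x /whiteW[]->; rewrite !inE eqxx ?orbT.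
have /subsetP sub_step := sub_psd_step (~: W).
apply/setP => w; rewrite in_setT /=; set B := psd_step e (~: W).
have whiteB x : x \notin B -> x = b1 \/ x = a3.
  move=> xB; have /whiteW : x \notin ~: W by apply: contra xB; apply: sub_step.
  by case=> Ex; [move: xB|left|right|move: xB]; rewrite // Ex ?step_a1 ?step_b3.
rewrite in_setU; have [//|Bw] := boolP (w \in B); apply/forcedP.
case: (whiteB w Bw) (Bw) => -> {}Bw; [exists b2 | exists a2].
- apply: (@psd_forcesI B _ _ [::] [:: a3]) => //;
    [exact: sub_step | | by rewrite /allrel /= n_b1a3].
  by move=> x /whiteB[]->; rewrite !inE eqxx ?orbT.
- apply: (@psd_forcesI B _ _ [::] [:: b1]) => //;
    [exact: sub_step | | by rewrite /allrel /= n_a3b1].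
  by move=> x /whiteB[]->; rewrite !inE eqxx ?orbT.
Qed.

(** Leave a maximum independent set white: its vertices are singleton white
    components, and each has a blue neighbour, so one step suffices. *)
Lemma throttling_independence :
  connected_graph e -> 1 < independence_number e ->
  psd_throttling_number e + independence_number e <= #|T| + 1.
Proof.
move=> conn alpha_gt1; have [A indA leA] := independence_number_geP e _ (leqnn _).
have T_gt1 : 1 < #|T| := leq_trans alpha_gt1 (leq_trans leA (max_card _)).
have no_isolated := connected_no_isolated conn T_gt1.
have /throttling_le th_le : iter 1 (psd_step e) (~: A) = setT.
  exact: independent_one_step.
by rewrite -(cardsC A) addnC -addnA leq_add.
Qed.

(** * Slow graphs *)

(** Two blue vertices forcing distinct vertices of one component would each
    miss the vertex forced by the other. *)
Lemma complete_throttling :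
  (forall x y, x != y -> e x y) -> #|T| <= psd_throttling_number e.
Proof.
move=> complete; apply: throttling_ge => S t St.
rewrite -(cardsC S) leq_add2l; apply: slow_forcing St => B _.
rewrite leqNgt; apply/negP => /card_gt1P[x [y [/forcedP[v vx] /forcedP[u uy] xy]]].
have [vB xB _] := psd_forces_edge vx; have [_ yB _] := psd_forces_edge uy.
have yCx := white_component_edge (white_component_refl _ _) xB yB (complete x y xy).
have yx : y != x by rewrite eq_sym.
have /negP[] := psd_forces_only vx yCx yB yx.
by apply: complete; apply: contraNneq yB => <-.
Qed.

Section SlowGraphs.
Hypothesis alpha_le2 :
  forall x y z, x != y -> x != z -> y != z -> ~~ e x y -> ~~ e x z -> e y z.
Hypothesis no_pentagon : forall v0 v1 v2 v3 v4, ~ pentagon e v0 v1 v2 v3 v4.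
Hypothesis no_double_diamond : ~ has_induced double_diamond_graph e.

(** Independence number 2 makes [z] adjacent to [v] and [v'], since [v]
    misses [y] and [v'] misses [x]; then [v' z v x y] is a pentagon. *)
Lemma far_vertex_forced_edge_absurd B v v' x y z :
  psd_forces e B v x -> psd_forces e B v' y -> e x y ->
  z != x -> z != y -> ~~ e z x -> ~~ e z y -> False.
Proof.
move=> vx v'y xy zx zy nzx nzy.
have [vB xB evx] := psd_forces_edge vx; have [v'B yB ev'y] := psd_forces_edge v'y.
have neq a b : a \in B -> b \notin B -> b != a by move=> aB; apply: contraNneq => ->.
have x_y : x != y by apply: contraTneq xy => ->; rewrite e_irr.
have xCy := white_component_edge (white_component_refl B x) xB yB xy.
have yCx : x \in white_component e B y by rewrite white_component_sym.
have nvy : ~~ e v y by apply: psd_forces_only vx xCy yB _; rewrite eq_sym.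
have nv'x : ~~ e v' x by apply: psd_forces_only v'y yCx xB _.
have z_v : z != v by apply: contraNneq nzx => ->.
have z_v' : z != v' by apply: contraNneq nzy => ->.
have ezv : e z v.
  by apply: (@alpha_le2 y) => //; rewrite 1?eq_sym 1?e_sym // eq_sym neq.
have ezv' : e z v'.
  by apply: (@alpha_le2 x) => //; rewrite 1?eq_sym 1?e_sym // eq_sym neq.
by apply: (@no_pentagon v' z v x y); split; split; rewrite // e_sym.
Qed.

(** If [z] lies outside the component, it sees neither [x] nor [y], which are
    then adjacent. If [z] lies inside, it is missed by both [v] and [v'], and
    [x z y v' v] is a pentagon whose free pair is [x y]. *)
Lemma forced_same_component_absurd B v v' x y z :
  psd_forces e B v x -> psd_forces e B v' y -> x != y ->
  y \in white_component e B x -> z \notin B -> z != x -> z != y -> False.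
Proof.
move=> vx v'y xy yCx zB zx zy.
have [vB xB evx] := psd_forces_edge vx; have [v'B yB ev'y] := psd_forces_edge v'y.
have neq a b : a \in B -> b \notin B -> a != b by move=> aB; apply: contraNneq => <-.
have xCy : x \in white_component e B y by rewrite white_component_sym.
have nvy : ~~ e v y by apply: psd_forces_only vx yCx yB _; rewrite eq_sym.
have nv'x : ~~ e v' x by apply: psd_forces_only v'y xCy xB _.
have [zCx|zCx] := boolP (z \in white_component e B x); last first.
  have nxz : ~~ e x z.
    by apply: contra zCx; apply: white_component_edge; rewrite ?white_component_refl.
  have nyz : ~~ e y z by apply: contra zCx; apply: white_component_edge.
  have exy : e x y by apply: (@alpha_le2 z) => //; rewrite e_sym.
  by apply: (far_vertex_forced_edge_absurd vx v'y exy zx zy); rewrite e_sym.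
have zCy : z \in white_component e B y by apply: white_component_trans zCx.
have nvz := psd_forces_only vx zCx zB zx.
have nv'z := psd_forces_only v'y zCy zB zy.
have v_v' : v != v' by apply: contraTneq evx => ->.
have exz : e x z.
  by apply: (@alpha_le2 v'); rewrite ?(neq v') // eq_sym.
have ezy : e z y by apply: (@alpha_le2 v); rewrite ?(neq v).
have ev'v : e v' v.
  have zneq u : u \in B -> z != u by move=> uB; rewrite eq_sym neq.
  by apply: (@alpha_le2 z); rewrite ?zneq // 1?eq_sym // e_sym.
by apply: (@no_pentagon x z y v' v); split; split; rewrite // e_sym.
Qed.

(** The components are cliques. The six vertices carry a double diamond, with
    [a2 = v'], [b2 = v], [a1 b1 = y1 y2] and [b3 a3 = x1 x2], as soon as [v] and
    [v'] are adjacent; otherwise the five vertices other than [x2] induce a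
    house. So simultaneous forces in two components exhaust one of them. *)
Lemma forced_two_components_absurd B v v' x1 x2 y1 y2 :
  psd_forces e B v x1 -> psd_forces e B v' y1 ->
  y1 \notin white_component e B x1 ->
  x2 \in white_component e B x1 -> x2 \notin B -> x2 != x1 ->
  y2 \notin white_component e B x1 -> y2 \notin B -> y2 != y1 -> False.
Proof.
move=> vx v'y y1C x2C x2B x21 y2C y2B y21.
have [vB x1B evx] := psd_forces_edge vx; have [v'B y1B ev'y] := psd_forces_edge v'y.
have x1C := white_component_refl B x1.
have sep x y : x \in white_component e B x1 -> y \notin white_component e B x1 ->
    x \notin B -> y \notin B -> (x != y) * ~~ e x y.
  move=> xC yC xB yB; split; first by apply: contraNneq yC => <-.
  by apply: contra yC; apply: white_component_edge.
have neq a b : a \in B -> b \notin B -> a != b by move=> aB; apply: contraNneq => <-.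
have [d11 n11] := sep x1 y1 x1C y1C x1B y1B.
have [d12 n12] := sep x1 y2 x1C y2C x1B y2B.
have [d2_1 n2_1] := sep x2 y1 x2C y1C x2B y1B.
have [d22 n22] := sep x2 y2 x2C y2C x2B y2B.
have nvx2 : ~~ e v x2 := psd_forces_only vx x2C x2B x21.
have ey : e y1 y2 by apply: (@alpha_le2 x1) => //; rewrite eq_sym.
have ex : e x1 x2.
  by apply: (@alpha_le2 y1) => //; rewrite 1?eq_sym 1?e_sym.
have nv'y2 : ~~ e v' y2.
  apply: (psd_forces_only v'y _ y2B y21).
  exact: white_component_edge (white_component_refl _ _) y1B y2B ey.
have neq' a b : a \in B -> b \notin B -> b != a by rewrite eq_sym; apply: neq.
have evy1 : e v y1.
  by apply: (@alpha_le2 x2); rewrite ?(neq v) ?(neq' v) // e_sym.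
have evy2 : e v y2.
  by apply: (@alpha_le2 x2); rewrite ?(neq v) ?(neq' v) // e_sym.
have ev'x1 : e v' x1.
  by apply: (@alpha_le2 y2); rewrite ?(neq v') ?(neq' v') // 1?eq_sym // e_sym.
have ev'x2 : e v' x2.
  by apply: (@alpha_le2 y2); rewrite ?(neq v') ?(neq' v') // 1?eq_sym // e_sym.
case vv' : (e v' v); last first.
  apply: (@no_pentagon v y2 y1 v' x1).
  by split; split; rewrite // e_sym ?vv'.
apply: no_double_diamond.
by apply: (@double_diamond_induced _ _ e_sym e_irr y1 v' x2 y2 v x1);
  split; rewrite // e_sym.
Qed.

(** A vertex that sees no white vertex makes the white set a single clique for
    the rest of the process, so two vertices forced at once would be adjacent
    and both missed by [z]. *)
Lemma far_vertex_white_le_time S z t :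
  z \in S -> (forall x, x \notin S -> ~~ e z x) ->
  iter t (psd_step e) S = setT -> #|~: S| <= t.
Proof.
move=> zS far; apply: slow_forcing => B subB.
rewrite leqNgt; apply/negP => /card_gt1P[x [y [/forcedP[v vx] /forcedP[v' vy] xy]]].
have [_ xB _] := psd_forces_edge vx; have [_ yB _] := psd_forces_edge vy.
have far_z w : w \notin B -> (z != w) * ~~ e z w.
  move=> wB; have wS : w \notin S by apply: contra wB; apply/subsetP.
  by split; [apply: contraNneq wS => <- | apply: far].
have [zx nzx] := far_z x xB; have [zy nzy] := far_z y yB.
by apply: (far_vertex_forced_edge_absurd vx vy _ zx zy nzx nzy);
   apply: (@alpha_le2 z).
Qed.

(** The process gains at most one vertex over one force per step: a step that
    forces two vertices either ends the process or leaves a blue vertex that sees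
    no white vertex, after which nothing more is gained. *)
Lemma white_le_time S t :
  iter t (psd_step e) S = setT -> #|~: S| <= t.+1.
Proof.
elim: t S => [|t IHt] S; first by move=> /= ->; rewrite setCT cards0.
rewrite iterSr => St; have [|] := leqP #|forced S| 1.
  move=> slow; apply: leq_trans (card_white_step S) _.
  by rewrite -[t.+2]addn1 leq_add ?IHt.
case/card_gt1P=> x [y [Fx Fy xy]].
have [/leq_trans->//|white_gt2] := leqP #|~: S| 2.
have other p q : exists z, [/\ z \notin S, z != p & z != q].
  have /card_gt0P[z] : 0 < #|~: S :\: [set p; q]|.
    rewrite cardsD subn_gt0 (leq_ltn_trans _ white_gt2) //.
    by rewrite (leq_trans (subset_leq_card (subsetIr _ _))) // cards2; case: (_ != _).
  by rewrite !inE negb_or => /andP[/andP[zp zq] zS]; exists z.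
(* A third white vertex exists, so no component receives two forces. *)
have apart p q : p \in forced S -> q \in forced S -> p != q ->
    q \notin white_component e S p.
  move=> /forcedP[v vp] /forcedP[v' v'q] pq; apply/negP => qCp.
  have [z [zS zp zq]] := other p q.
  exact: (forced_same_component_absurd vp v'q pq qCp zS).
have forced_white p : p \in forced S -> p \notin S.
  by case/forcedP=> v /psd_forces_edge[].
have nedge p q :
    p \notin S -> q \notin S -> q \notin white_component e S p -> ~~ e p q.
  move=> pS qS; apply: contra.
  by apply: white_component_edge; rewrite ?white_component_refl.
(* Three forces would occur in three components, against independence
   number 2. *)
have F2 : #|forced S| <= 2.
  rewrite leqNgt; apply/negP => /card_gt2P[p [q [r [[Fp Fq Fr] [pq qr rp]]]]].
  rewrite eq_sym in rp.
  have /negP[] : ~~ e q r by apply: nedge; rewrite ?forced_white ?apart.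
  by apply: (@alpha_le2 p) => //; apply: nedge; rewrite ?forced_white ?apart.
have [xS yS] := (forced_white x Fx, forced_white y Fy).
have [/forcedP[v vx] /forcedP[v' v'y]] := (Fx, Fy).
have [Sx Sy] : x \in psd_step e S /\ y \in psd_step e S.
  by rewrite !in_setU (Fx : x \in [set _ | _]) (Fy : y \in [set _ | _]) !orbT.
have later u : u \notin psd_step e S -> [/\ u \notin S, u != x & u != y].
  move=> uS; split; first by apply: contra uS; apply/subsetP/sub_psd_step.
  - by apply: contraNneq uS => ->.
  - by apply: contraNneq uS => ->.
suff: #|~: psd_step e S| <= t.
  move=> le_t; apply: leq_trans (card_white_step S) _.
  by rewrite -[t.+2]addn2 leq_add.
(* If the component of [x] has a second white vertex [x2], then that of [y]
   is exhausted and [y] is the far vertex; otherwise [x] is. *)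
have [/existsP[x2 /and3P[x2C x2S x2x]]|noX] :=
    boolP [exists u, [&& u \in white_component e S x, u \notin S & u != x]].
  apply: (far_vertex_white_le_time Sy) St => u /later[uS _ uy].
  have [uC|uC] := boolP (u \in white_component e S x).
    by rewrite e_sym; apply: contra (apart x y Fx Fy xy); apply: white_component_edge.
  by case: (forced_two_components_absurd vx v'y (apart x y Fx Fy xy)
              x2C x2S x2x uC uS uy).
apply: (far_vertex_white_le_time Sx) St => u /later[uS ux _]; apply: nedge => //.
by apply: contra noX => uC; apply/existsP; exists u; rewrite uC uS.
Qed.

End SlowGraphs.

End Forcing.

Theorem theorem5p12 (T : finType) (e : rel T)
    (e_sym : symmetric e) (e_irr : irreflexive e)
    (e_conn : connected_graph e) :
  in_family_G e <-> psd_throttling_number e = #|T| - 1.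
Proof.
have T_gt0 : 0 < #|T| by case: e_conn.
split=> [[alpha2 noC5 noHouse noDD] | th].
  apply/eqP; rewrite eqn_leq; apply/andP; split.
    have := throttling_independence e_sym e_conn; rewrite alpha2 => /(_ isT).
    by rewrite addn2 addn1 ltnS leq_subRL // add1n.
  apply: throttling_ge => S t St; rewrite leq_subLR addnCA.
  rewrite -(cardsC S) leq_add2l add1n.
  apply: (white_le_time e_sym e_irr _ _ noDD) St; last first.
    by move=> v0 v1 v2 v3 v4 /(pentagon_induced e_sym e_irr)[].
  move=> x y z xy xz yz nxy nxz; apply/negPn/negP => nyz.
  suff: 2 < independence_number e by rewrite alpha2.
  by apply/independence_number_gt2P => //; exists x, y, z.
have alpha_gt1 : 1 < independence_number e.
  apply/independence_number_gt1P => //.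
  have [complete|] := boolP [forall x, forall y, (x != y) ==> e x y].
    have /complete_throttling : forall x y, x != y -> e x y.
      by move=> x y; apply/implyP; move: y; apply/forallP; move: x; apply/forallP.
    by rewrite th leqNgt ltn_subrL T_gt0.
  case/forallPn=> x /forallPn[y]; rewrite negb_imply => /andP[xy nxy].
  by exists x, y.
split.
- have := throttling_independence e_sym e_conn alpha_gt1.
  rewrite th -(leq_add2l 1) addnA subnKC // addnCA leq_add2l => alpha_le2.
  by apply/eqP; rewrite eqn_leq alpha_le2.
- move=> /or_introl/induced_pentagon [v0 [v1 [v2 [v3 [v4]]]]].
  by move/(pentagon_throttling e_sym e_irr); rewrite th ltnn.
- move=> /or_intror/induced_pentagon [v0 [v1 [v2 [v3 [v4]]]]].
  by move/(pentagon_throttling e_sym e_irr); rewrite th ltnn.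
- by move/double_diamond_throttling; rewrite th ltnn.
Qed.
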